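(* Let $\mathbb{F}$ be a field and let $K$ be a finite simplicial complex with $m$ vertices. The following conditions are equivalent: (1) $K$ is weakly taut over $\mathbb{F}$. (2) The number of minimal non-faces of $K$ is equal to $m-\mathrm{mdim}(K)-1$. (3) $K$ has a minimal Taylor resolution.
   Context: A finite simplicial complex $K$ with vertex set $V(K)=[m]=\{v_1,\dots,v_m\}$ contains $\varnothing$ and every singleton $\{v_i\}$ as a face. The dimension of a face $\sigma$ is $|\sigma|-1$, and $\mathrm{mdim}(K)$ is the minimal dimension of the maximal simplices of $K$. For a field $\mathbb{F}$, $\mathbb{F}[K]=\mathbb{F}[v_1,\dots,v_m]/\mathcal{I}_K$ is the Stanley-Reisner ring and $\widetilde{D}(K;\mathbb{F})=\dim_{\mathbb{F}}\mathrm{Tor}_{\mathbb{F}[v_1,\dots,v_m]}(\mathbb{F}[K],\mathbb{F})$; equivalently (Hochster's formula) $\widetilde{D}(K;\mathbb{F})=\sum_{J\subseteq[m]}\sum_{i\ge -1}\dim_{\mathbb{F}}\widetilde{H}_i(K|_J;\mathbb{F})$, where $K|_J$ is the full subcomplex on $J$ and $\widetilde{H}_{-1}(\{\varnothing\};\mathbb{F})=\mathbb{F}$ is the only nonzero reduced homology group of $\{\varnothing\}$. $K$ is weakly taut over $\mathbb{F}$ if $\widetilde{D}(K;\mathbb{F})=2^{m-\mathrm{mdim}(K)-1}$. A non-empty $J\subseteq V(K)$ is a minimal non-face if $J\notin K$ but $J\setminus\{v\}\in K$ for every $v\in J$. Let $N_1,\dots,N_r$ be all the minimal non-faces of $K$.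 For $N\subseteq V(K)$ let $v_N$ be the corresponding squarefree monomial, with $v_\varnothing=1$. The Taylor resolution of $\mathbb{F}[K]$ is the free resolution $\cdots\to R^{-\ell}\xrightarrow{d}R^{-\ell+1}\to\cdots\to R^0=\mathbb{F}[v_1,\dots,v_m]\to\mathbb{F}[K]$ over $\mathbb{F}[v_1,\dots,v_m]$, where $R^{-\ell}$ is free on symbols $w_{i_1,\dots,i_\ell}$, $1\le i_1<\cdots<i_\ell\le r$, and $$d(w_{i_1,\dots,i_\ell})=\sum_{k=1}^{\ell}(-1)^{k+1}v_{N_{i_k}\setminus(N_{i_1}\cup\cdots\cup\widehat{N_{i_k}}\cup\cdots\cup N_{i_\ell})}\,w_{i_1,\dots,\widehat{i_k},\dots,i_\ell}.$$ It is minimal if $d\otimes_{\mathbb{F}[v_1,\dots,v_m]}\mathbb{F}=0$, where $\mathbb{F}$ is the trivial module (all $v_i$ act by $0$). Minimality does not depend on the field; $K$ is said to have a minimal Taylor resolution if the Taylor resolution of $\mathbb{F}[K]$ is minimal for some field $\mathbb{F}$. *)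

(* Defs.v *)
From HB Require Import structures.
From mathcomp Require Import all_boot all_order all_algebra.
From mathcomp Require Import mpoly.

Set Implicit Arguments.
Unset Strict Implicit.
Unset Printing Implicit Defensive.

Import Order.TTheory GRing.Theory Num.Theory.
Local Open Scope ring_scope.

Definition simplicial_complex (m : nat) (K : {set {set 'I_m}}) : Prop :=
  [/\ set0 \in K,
      forall v : 'I_m, [set v] \in K
    & forall s t : {set 'I_m}, s \in K -> t \subset s -> t \in K].

Definition face_dim (m : nat) (s : {set 'I_m}) : int := #|s|%:Z - 1.

Definition facets (m : nat) (K : {set {set 'I_m}}) : {set {set 'I_m}} :=
  [set s | maxset (fun t => t \in K) s].

(* The default value m - 1 bounds all face dimensions from above, so that it
   is neutral for the minimum; a complex always has at least one facet. *)
Definition mdim (m : nat) (K : {set {set 'I_m}}) : int :=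
  \big[Num.min/m%:Z - 1]_(s in facets K) face_dim s.

Definition full_subcomplex (m : nat) (K : {set {set 'I_m}})
  (J : {set 'I_m}) : {set {set 'I_m}} := [set s in K | s \subset J].

(* The sign (-1)^j, where v is the j-th element of A (counting from 0) in
   increasing order. *)
Definition del_sign (R : nzRingType) (n : nat) (A : {set 'I_n}) (v : 'I_n) : R :=
  (-1) ^+ #|[set u in A | (u < v)%N]|.

Definition simplices (m : nat) (K : {set {set 'I_m}}) (i : int) :
  {set {set 'I_m}} := [set s in K | face_dim s == i].

Definition incidence (R : nzRingType) (n : nat) (s t : {set 'I_n}) : R :=
  \sum_(v in s | s :\ v == t) del_sign R s v.

(* The differential C_i(K; F) -> C_{i-1}(K; F) of the augmented simplicial
   chain complex, acting on row vectors. Simplices are oriented by the order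
   of 'I_m; C_{-1} is spanned by the empty face and C_{-2} = 0. *)
Definition boundary (F : fieldType) (m : nat) (K : {set {set 'I_m}}) (i : int) :
    'M[F]_(#|simplices K i|, #|simplices K (i - 1)|) :=
  \matrix_(a < #|simplices K i|, b < #|simplices K (i - 1)|)
    incidence F (enum_val a) (enum_val b).

Definition reduced_betti (F : fieldType) (m : nat) (K : {set {set 'I_m}})
    (i : int) : nat :=
  (\rank (kermx (boundary F K i)) - \rank (boundary F K (i + 1)))%N.

(* The total dimension of Tor(F[K], F), in the form given by Hochster's formula.
   The index k stands for the homological degree i = k - 1; degrees outside
   -1 <= i <= m - 1 carry no simplices. *)
Definition Dtilde (F : fieldType) (m : nat) (K : {set {set 'I_m}}) : nat :=
  \sum_(J : {set 'I_m}) \sum_(k < m.+1)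
    reduced_betti F (full_subcomplex K J) (k%:Z - 1).

Definition weakly_taut (F : fieldType) (m : nat) (K : {set {set 'I_m}}) : Prop :=
  (Dtilde F K)%:R = 2 ^ (m%:Z - mdim K - 1) :> rat.

Definition minimal_nonfaces (m : nat) (K : {set {set 'I_m}}) :
    {set {set 'I_m}} :=
  [set N | [&& N != set0, N \notin K & [forall v in N, N :\ v \in K]]].

Definition minimal_nonface (m : nat) (K : {set {set 'I_m}})
    (i : 'I_#|minimal_nonfaces K|) : {set 'I_m} := enum_val i.

Definition sqfree_monomial (F : fieldType) (m : nat) (N : {set 'I_m}) :
  {mpoly F[m]} := \prod_(i in N) 'X_i.

(* The index set of the basis of the l-th free module: the symbol
   w_{i_1, ..., i_l} is encoded by the set {i_1, ..., i_l}. *)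
Definition taylor_basis (r l : nat) : {set {set 'I_r}} :=
  [set A : {set 'I_r} | #|A| == l].

Definition taylor_coef (F : fieldType) (m : nat) (K : {set {set 'I_m}})
    (A B : {set 'I_#|minimal_nonfaces K|}) : {mpoly F[m]} :=
  \sum_(k in A | A :\ k == B)
    del_sign {mpoly F[m]} A k
    * sqfree_monomial F
        (minimal_nonface k :\: \bigcup_(j in A :\ k) minimal_nonface j).

(* The Taylor differential R^{-(l+1)} -> R^{-l}, acting on row vectors. *)
Definition taylor_diff (F : fieldType) (m : nat) (K : {set {set 'I_m}})
    (l : nat) :
    'M[{mpoly F[m]}]_(#|taylor_basis #|minimal_nonfaces K| l.+1|,
                      #|taylor_basis #|minimal_nonfaces K| l|) :=
  \matrix_(a < #|taylor_basis #|minimal_nonfaces K| l.+1|,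
           b < #|taylor_basis #|minimal_nonfaces K| l|)
    taylor_coef F (enum_val a) (enum_val b).

(* Tensoring with the trivial module sends every variable to 0. *)
Definition taylor_minimal (F : fieldType) (m : nat) (K : {set {set 'I_m}}) :
    Prop :=
  forall l : nat, map_mx (meval (fun _ => 0 : F)) (taylor_diff F K l) = 0.

Definition has_minimal_taylor_resolution (m : nat) (K : {set {set 'I_m}}) :
  Prop := exists F : fieldType, taylor_minimal F K.

(* Main.v *)
(* All homology is computed from ranks: the total Betti number of K is
   #|K| - 2 rank(B_K), where B_K is the boundary matrix restricted to K, and for
   every vertex v the long exact sequence of (K, K - v) becomes a rank
   inequality, betti(link v) <= betti(K - v) + betti(K), with equality iff every
   cycle of K - v bounds in K. Summing over full subcomplexes gives
   D(link v) <= 2 D(K) (v staying as a ghost vertex of the link), so that descending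
   along a facet s yields D(K) >= 2 ^ (m - #|s|).
   If K is weakly taut, equality holds at every step. A minimal non-face N
   missing v is a cycle of the deletion, so it is filled by the faces v * (N - u);
   hence N |-> N - v embeds the minimal non-faces of K into those of the link,
   and by induction there are at most m - #|s| of them.
   On the other hand every vertex outside a facet s is the only vertex outside s of
   some minimal non-face, so there are at least m - mdim K - 1 minimal non-faces,
   with equality iff each of them has a private vertex, which is the minimality of
   the Taylor resolution. In that case a full subcomplex K_J is a
   cone unless J is a union of minimal non-faces, when its total Betti number is at
   most 1, by passing to links of non-private vertices; so D(K) <= 2 ^ r. *)

Require Import Defs.
From HB Require Import structures.
From mathcomp Require Import all_boot all_order all_algebra.
From mathcomp Require Import mpoly.
From mathcomp Require Import zify.

Set Implicit Arguments.
Unset Strict Implicit.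
Unset Printing Implicit Defensive.

Import Order.TTheory GRing.Theory Num.Theory.
Local Open Scope ring_scope.

(** * Matrices indexed by the subsets of the vertex set *)

Section ChainMatrices.

Variables (F : fieldType) (m : nat).
Local Notation face := {set 'I_m}.
Local Notation N := #|{set 'I_m}|.
Implicit Types (K L X Y : {set face}) (s t J : face) (u v : 'I_m).

(** All families act inside one space with basis the subsets of the vertex set, so operators
    attached to different families compose without changing dimension. *)
Definition face_matrix (f : face -> face -> F) : 'M[F]_N :=
  \matrix_(a, b) f (enum_val a) (enum_val b).

Lemma mul_face_matrix f g :
  face_matrix f *m face_matrix g =
  face_matrix (fun s t => \sum_r f s r * g r t).
Proof.
apply/matrixP => a b; rewrite !mxE.
rewrite [RHS](reindex (fun i : 'I_N => enum_val i)); last exact/onW_bij/enum_val_bij.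
by apply: eq_bigr => i _; rewrite !mxE.
Qed.

Lemma face_matrix1 : face_matrix (fun s t => (s == t)%:R) = 1%:M.
Proof. by apply/matrixP=> a b; rewrite !mxE (inj_eq enum_val_inj). Qed.

Lemma eq_face_matrix f g : f =2 g -> face_matrix f = face_matrix g.
Proof. by move=> e; apply/matrixP=> a b; rewrite !mxE e. Qed.

Lemma face_matrix_inj f g : face_matrix f = face_matrix g -> f =2 g.
Proof.
move=> /matrixP e s t; have := e (enum_rank s) (enum_rank t).
by rewrite !mxE !enum_rankK.
Qed.

Definition face_proj X := face_matrix (fun s t => ((s == t) && (s \in X))%:R).

Lemma mul_projl X f :
  face_proj X *m face_matrix f = face_matrix (fun s t => (s \in X)%:R * f s t).
Proof.
rewrite mul_face_matrix; apply: eq_face_matrix => s t.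
rewrite (bigD1 s) //= eqxx big1 ?addr0 // => r /negPf.
by rewrite eq_sym => ->; rewrite mul0r.
Qed.

Lemma mul_projr X f :
  face_matrix f *m face_proj X = face_matrix (fun s t => f s t * (t \in X)%:R).
Proof.
rewrite mul_face_matrix; apply: eq_face_matrix => s t.
rewrite (bigD1 t) //= eqxx big1 ?addr0 // => r /negPf.
by move=> ->; rewrite mulr0.
Qed.

Lemma face_projM X Y : face_proj X *m face_proj Y = face_proj (X :&: Y).
Proof.
rewrite mul_projl; apply: eq_face_matrix => s t; rewrite inE.
by case: (s \in X); rewrite ?mul1r ?mul0r ?andbF.
Qed.

Lemma rank_submatrix X Y f :
  \rank (\matrix_(a < #|X|, b < #|Y|) f (enum_val a) (enum_val b) : 'M[F]_(_, _))
  = \rank (face_proj X *m face_matrix f *m face_proj Y).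
Proof.
(* The rows of [E Z] are the basis vectors of the members of [Z]. As [E Z *m (E Z)^T] is the
   identity, the submatrix and its ambient version are obtained from each other by
   multiplication. *)
pose E Z : 'M[F]_(#|Z|, N) :=
  \matrix_(a, b) (enum_val a == enum_val b :> face)%:R.
have EM (Z : {set face}) p (A : 'M_(N, p)) :
  E Z *m A = \matrix_(a, b) A (enum_rank (enum_val a : face)) b.
  apply/matrixP=> a b; rewrite !mxE (bigD1 (enum_rank (enum_val a))) //= !mxE.
  rewrite enum_rankK eqxx mul1r big1 ?addr0 // => i ni; rewrite !mxE.
  by case: eqP; rewrite ?mul0r // => e; rewrite e enum_valK eqxx in ni.
have EET (Z : {set face}) : E Z *m (E Z)^T = 1%:M.
  apply/matrixP=> a b; rewrite EM !mxE enum_rankK eq_sym.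
  by rewrite (inj_eq enum_val_inj).
have ETE (Z : {set face}) : (E Z)^T *m E Z = face_proj Z.
  apply/matrixP=> a b; rewrite !mxE; case: (boolP (enum_val a \in Z)) => aZ.
    rewrite (bigD1 (enum_rank_in aZ (enum_val a))) //= !mxE.
    rewrite enum_rankK_in // eqxx mul1r andbT big1 ?addr0 // => i ni.
    rewrite !mxE; case: eqP; rewrite ?mul0r // => e.
    by move: ni; rewrite -(inj_eq enum_val_inj) enum_rankK_in // e eqxx.
  rewrite andbF big1 // => i _; rewrite !mxE; case: eqP; rewrite ?mul0r // => e.
  by rewrite -e enum_valP in aZ.
set M := (X in \rank X).
have -> : M = E X *m face_matrix f *m (E Y)^T.
  rewrite -[RHS]trmxK trmx_mul trmxK EM EM.
  by apply/matrixP=> a b; rewrite !mxE !enum_rankK.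
set A := E X *m _ *m _.
have -> : face_proj X *m face_matrix f *m face_proj Y = (E X)^T *m A *m E Y.
  by rewrite /A -!ETE !mulmxA.
apply/eqP; rewrite eqn_leq; apply/andP; split; last first.
  exact: leq_trans (mxrankM_maxl _ _) (mxrankM_maxr _ _).
have {1}-> : A = E X *m ((E X)^T *m A *m E Y) *m (E Y)^T.
  by rewrite !mulmxA EET mul1mx -[RHS]mulmxA EET mulmx1.
exact: leq_trans (mxrankM_maxl _ _) (mxrankM_maxr _ _).
Qed.

End ChainMatrices.

(** * The boundary and cone operators *)

Section Boundary.

Variables (F : fieldType) (m : nat).
Local Notation face := {set 'I_m}.
Implicit Types (s t A : face) (u v : 'I_m).
Local Notation sgn := (@del_sign F m).

Definition boundary_matrix := face_matrix (@incidence F m).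

(** The cone contraction of the full simplex; the sign is that of moving [v] from the front to its
    sorted place. *)
Definition cone_matrix v : 'M[F]_#|{set 'I_m}| :=
  face_matrix (fun s t => ((v \notin s) && (t == v |: s))%:R * sgn t v).

Local Notation B := boundary_matrix.

Lemma del_sign_sqr A v : sgn A v * sgn A v = 1.
Proof. by rewrite /del_sign -expr2 sqrr_sign. Qed.

Lemma del_signD1 A u v : u \in A -> sgn (A :\ u) v = (-1) ^+ (u < v)%N * sgn A v.
Proof.
move=> uA; rewrite /del_sign (cardsD1 u [set w in A | _]) inE uA /= exprD mulrA.
rewrite -signr_addb addbb mul1r; congr (_ ^+ #|pred_of_set _|).
by apply/setP=> w; rewrite !inE andbA.
Qed.

(** Deleting the smaller vertex first shifts the position of the larger one by one; the other order
    shifts nothing. *)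
Lemma del_sign_anti A u v : u \in A -> v \in A -> u != v ->
  sgn A u * sgn (A :\ u) v = - (sgn A v * sgn (A :\ v) u).
Proof.
move=> uA vA nuv; rewrite !del_signD1 // mulrCA [sgn A v * _]mulrCA -mulNr.
rewrite [sgn A v * _]mulrC; congr (_ * _).
by case: (ltngtP u v) nuv => [_|_|/val_inj->]; rewrite ?eqxx ?opprK.
Qed.

(** Terms with [u < v] cancel those with [v < u]; the zero diagonal is a separate hypothesis because
    antisymmetry does not give it in characteristic 2. *)
Lemma antisymmetric_sum0 (f : 'I_m -> 'I_m -> F) :
  (forall u, f u u = 0) -> (forall u v, f u v = - f v u) ->
  \sum_u \sum_v f u v = 0.
Proof.
move=> f0 fN.
have -> : \sum_u \sum_v f u v =
    \sum_(u : 'I_m) \sum_(v : 'I_m | (u < v)%N) f u v +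
    \sum_(u : 'I_m) \sum_(v : 'I_m | (v < u)%N) f u v.
  rewrite -big_split; apply: eq_bigr => u _ /=.
  rewrite (bigID (fun v : 'I_m => (u < v)%N)) /=; congr (_ + _).
  rewrite (bigD1 u) ?ltnn //= f0 add0r; apply: eq_bigl => v.
  by rewrite -leqNgt ltn_neqAle andbC.
rewrite [X in _ + X](exchange_big_dep xpredT) //= -big_split big1 // => u _.
by rewrite /= -big_split big1 // => v _; rewrite /= fN addNr.
Qed.

Lemma sum_incidence s (g : face -> F) :
  \sum_r incidence F s r * g r = \sum_(u in s) sgn s u * g (s :\ u).
Proof.
under eq_bigr do rewrite big_distrl /=.
rewrite (exchange_big_dep (mem s)) /=; last by move=> r u _ /andP[].
apply: eq_bigr => u us; rewrite (big_pred1 (s :\ u)) // => r.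
  by rewrite us eq_sym.
Qed.

Lemma boundary_sqr0 : B *m B = 0.
Proof.
rewrite mul_face_matrix; apply/matrixP=> a b; rewrite !mxE sum_incidence.
set s := enum_val a; set t := enum_val b.
pose f u v := if [&& u \in s, v \in s :\ u & s :\ u :\ v == t]
              then sgn s u * sgn (s :\ u) v else 0.
transitivity (\sum_u \sum_v f u v).
  rewrite big_mkcond; apply: eq_bigr => u _; rewrite /f.
  case: (boolP (u \in s)) => us /=; last by rewrite big1.
  by rewrite -big_mkcond big_distrr.
apply: antisymmetric_sum0 => [u|u v]; rewrite /f.
  by rewrite setD11 /= andbF.
rewrite !inE [v == u]eq_sym !setDDl [[set v; u]]setUC.
case: (boolP (u == v)) => [/eqP->|nuv] /=; first by rewrite !andbF oppr0.
case: (boolP (u \in s)) => us; case: (boolP (v \in s)) => vs; rewrite ?oppr0 //=.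
by case: eqP => _; rewrite ?oppr0 // del_sign_anti.
Qed.

(** If [v] is in [s], only the facet [s :\ v] has a non-zero cone, which is [s]. Otherwise deleting
    [v] from the cone returns [s], and the other facets of the cone cancel the cones over the facets
    of [s]. *)
Lemma cone_homotopy v : cone_matrix v *m B + B *m cone_matrix v = 1%:M.
Proof.
rewrite !mul_face_matrix -face_matrix1; apply/matrixP=> a b; rewrite !mxE.
set s := enum_val a; set t := enum_val b; rewrite sum_incidence.
case: (boolP (v \in s)) => vs.
  rewrite big1 ?add0r => [|r _]; last by rewrite !mul0r.
  rewrite (bigD1 v) //= setD11 setD1K // big1 ?addr0 => [|u /andP[us nuv]].
    rewrite [t == s]eq_sym; case: eqP => [->|_]; first by rewrite mul1r del_sign_sqr.
    by rewrite mul0r mulr0.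
  by rewrite !inE vs eq_sym nuv /= mul0r mulr0.
rewrite (bigD1 (v |: s)) //= eqxx mul1r [X in _ + X + _]big1 ?addr0; last first.
  by move=> r /negPf->; rewrite !mul0r.
rewrite /incidence big_mkcondr (bigD1 v) ?setU11 //= setU1K //.
rewrite mulrDr -addrA [X in _ + X](_ : _ = 0) ?addr0.
  by case: eqP; rewrite ?del_sign_sqr ?mulr0.
rewrite big_distrr /= (eq_bigl (fun u => u \in s)) => [|u]; last first.
  by rewrite !inE; case: eqP => [->|_]; rewrite ?(negPf vs) ?andbT.
rewrite -big_split big1 //= => u us.
have nvu : v != u by apply: contraNneq vs => ->.
have e : v |: s :\ u = (v |: s) :\ u.
  by apply/setP=> w; rewrite !inE; case: (w =P v) => [->|] //=; rewrite nvu.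
rewrite in_setD1 (negPf vs) andbF e [t == _]eq_sym /=.
case: eqP => [<-|_]; last by rewrite mul0r !mulr0 addr0.
have := @del_sign_anti (v |: s) v u (setU11 _ _) (setU1r _ us) nvu.
rewrite setU1K // => anti; rewrite mul1r.
rewrite -[sgn s u]mul1r -(del_sign_sqr (v |: s) v) -(mulrA (sgn _ v)) anti.
by rewrite mulrN mulNr -!mulrA del_sign_sqr mulr1 subrr.
Qed.

End Boundary.

(** Links have ghost vertices, and the link of a ghost vertex is empty; so neither the singletons
    nor the empty face may be required. *)
Definition downset (m : nat) (K : {set {set 'I_m}}) : Prop :=
  forall s t : {set 'I_m}, s \in K -> t \subset s -> t \in K.

Definition deletion (m : nat) (K : {set {set 'I_m}}) (v : 'I_m) :=
  [set s in K | v \notin s].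

(* A family on the same ground set: v becomes a ghost vertex. *)
Definition link (m : nat) (K : {set {set 'I_m}}) (v : 'I_m) : {set {set 'I_m}} :=
  [set s : {set 'I_m} | (v \notin s) && (v |: s \in K)].

Definition total_betti (F : fieldType) (m : nat) (K : {set {set 'I_m}}) : nat :=
  \sum_(k < m.+1) reduced_betti F K (k%:Z - 1).

(** * Betti numbers as ranks *)

Section BoundaryRank.

Variables (F : fieldType) (m : nat).
Local Notation face := {set 'I_m}.
Implicit Types (s t : face) (u v : 'I_m) (K X Y : {set face}).

Local Notation B := (boundary_matrix F m).
Local Notation D := (@face_proj F m).

Definition boundary_rank K : nat := \rank (D K *m B).
Local Notation rho := boundary_rank.

Lemma card_face_le s : (#|s| <= m)%N.
Proof. by rewrite -[X in (_ <= X)%N]card_ord max_card. Qed.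

Lemma incidence_neq0 s t :
  incidence F s t != 0 -> exists2 u, u \in s & t = s :\ u.
Proof.
move=> nz; have [u /andP[us /eqP<-]|no] :=
    pickP (fun u => (u \in s) && (s :\ u == t)); first by exists u.
by case/eqP: nz; rewrite /incidence big_pred0.
Qed.

Lemma incidenceD1_neq0 s u : u \in s -> incidence F s (s :\ u) != 0.
Proof.
move=> us; rewrite /incidence (big_pred1 u) ?signr_eq0 // => v /=.
apply/andP/eqP => [[vs /eqP/setP/(_ v)]|-> //].
by rewrite setD11 !inE vs andbT; case: eqP.
Qed.

Lemma rank_face_proj K : \rank (D K) = #|K|.
Proof.
have := rank_submatrix K K (fun s t : face => (s == t)%:R : F).
rewrite face_matrix1 mulmx1 face_projM setIid => <-.
rewrite -[RHS](mxrank1 F); congr (\rank _).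
by apply/matrixP=> a b; rewrite !mxE (inj_eq enum_val_inj).
Qed.

Lemma face_proj_sub X Y : X \subset Y -> D X *m D Y = D X.
Proof. by move=> /setIidPl XY; rewrite face_projM XY. Qed.

Lemma face_proj_disjoint X Y : [disjoint X & Y] -> D X *m D Y = 0.
Proof.
rewrite -setI_eq0 face_projM => /eqP->.
by apply/matrixP=> a b; rewrite !mxE in_set0 andbF.
Qed.

Lemma face_projU X Y : [disjoint X & Y] -> D (X :|: Y) = D X + D Y.
Proof.
move=> dXY; apply/matrixP=> a b; rewrite !mxE inE.
case: (boolP (enum_val a \in X)) => [aX|_]; last by rewrite andbF add0r.
by rewrite (disjointFr dXY aX) andbF addr0.
Qed.

Lemma sub_face_proj_id X n (A : 'M[F]_(n, _)) : (A <= D X)%MS -> A *m D X = A.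
Proof. by case/submxP=> W ->; rewrite -mulmxA face_projM setIid. Qed.

Lemma boundary_proj X Y :
    (forall s u, s \in X -> u \in s -> s :\ u \in Y) ->
  D X *m B *m D Y = D X *m B.
Proof.
move=> XY; rewrite mul_projl mul_projr; apply: eq_face_matrix => s t.
case: (boolP (s \in X)) => sX; last by rewrite !mul0r.
have [->|/incidence_neq0[u us ->]] := eqVneq (incidence F s t) 0.
  by rewrite mulr0 mul0r.
by rewrite XY // mulr1.
Qed.

Lemma boundary_projC X Y :
    (forall s u, s \in X -> u \in s -> s :\ u \notin Y) -> D X *m B *m D Y = 0.
Proof.
move=> XY; rewrite -(@boundary_proj X (~: Y)) => [|s u sX us]; last first.
  by rewrite inE XY.
by rewrite -mulmxA face_proj_disjoint ?mulmx0 // disjoints_subset.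
Qed.

Lemma downset_proj K : downset K -> D K *m B *m D K = D K *m B.
Proof. by move=> dK; apply: boundary_proj => s u sK _; apply: dK (subD1set _ _). Qed.

Lemma boundary_rank_kernel K : (rho K + \rank (D K :&: kermx B))%N = #|K|.
Proof. by rewrite -rank_face_proj mxrank_mul_ker. Qed.

(** The two images lie in the spans of disjoint sets of basis vectors, so they meet in zero. *)
Lemma boundary_rankU X Y X' Y' :
    [disjoint X & Y] -> [disjoint X' & Y'] ->
    (forall s u, s \in X -> u \in s -> s :\ u \in X') ->
    (forall s u, s \in Y -> u \in s -> s :\ u \in Y') ->
  rho (X :|: Y) = (rho X + rho Y)%N.
Proof.
move=> dXY dXY' bX bY; rewrite /rho -mxrank_disjoint_sum; last first.
  have capX : (D X *m B :&: D Y *m B <= D X')%MS.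
    by rewrite (submx_trans (capmxSl _ _)) // -(boundary_proj bX) submxMl.
  have capY : (D X *m B :&: D Y *m B <= D Y')%MS.
    by rewrite (submx_trans (capmxSr _ _)) // -(boundary_proj bY) submxMl.
  rewrite -(sub_face_proj_id capY) -(sub_face_proj_id capX) -mulmxA.
  by rewrite face_proj_disjoint // mulmx0.
apply: eqmx_rank; apply/andP; split.
  by rewrite face_projU // mulmxDl addmx_sub_adds.
rewrite addsmx_sub -{1}(face_proj_sub (subsetUl X Y)).
by rewrite -{1}(face_proj_sub (subsetUr X Y)) -!mulmxA !submxMl.
Qed.

Lemma cycle_proj X Y :
    (forall s u, s \in X -> u \in s -> s :\ u \in Y) ->
  (D X *m B <= D Y :&: kermx B)%MS.
Proof.
move=> XY; rewrite sub_capmx -{1}(boundary_proj XY) submxMl.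
by apply/sub_kermxP; rewrite -mulmxA boundary_sqr0 mulmx0.
Qed.

Lemma mem_simplices K i s : (s \in simplices K i) = (s \in K) && (#|s|%:Z - 1 == i).
Proof. by rewrite inE. Qed.

Lemma simplicesD1 K i s u : downset K ->
  s \in simplices K i -> u \in s -> s :\ u \in simplices K (i - 1).
Proof.
move=> dK; rewrite !mem_simplices (cardsD1 u s) => /andP[sK /eqP<-] us.
rewrite (dK s) ?subD1set //= us. by rewrite add1n; move: #|_| => n; lia.
Qed.

Lemma reduced_betti_rank K i : downset K ->
  (reduced_betti F K i + rho (simplices K i) + rho (simplices K (i + 1)))%N
  = #|simplices K i|.
Proof.
move=> dK; have rE j : \rank (boundary F K j) = rho (simplices K j).
  rewrite rank_submatrix -/(boundary_matrix F m) boundary_proj // => s u.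
  exact: simplicesD1.
rewrite /reduced_betti mxrank_ker !rE.
have := boundary_rank_kernel (simplices K i).
(* Boundaries are cycles, so the subtraction in [reduced_betti] is not truncated. *)
suff : (rho (simplices K (i + 1)) <= \rank (D (simplices K i) :&: kermx B))%N by lia.
apply/mxrankS/cycle_proj => s u sK us.
by rewrite -[i](addrK 1); apply: simplicesD1 us.
Qed.

Lemma boundary_rank0 X : (forall s, s \in X -> s = set0) -> rho X = 0%N.
Proof.
move=> X0; apply/eqP; rewrite mxrank_eq0; apply/eqP.
rewrite -(@boundary_proj X setT) ?boundary_projC // => s u /X0->; rewrite !inE //.
Qed.

Lemma boundary_rank_graded K : downset K ->
  rho K = (\sum_(k < m.+1) rho (simplices K (k%:Z - 1)))%N.
Proof.
(* [K_ n] is a skeleton cut by cardinality; passing to [n.+1] adds exactly the simplices of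
   dimension [n - 1], whose boundaries lie in a new degree. *)
move=> dK; pose K_ n := [set s in K | (#|s| < n)%N].
have -> : rho K = rho (K_ m.+1).
  congr rho; apply/setP=> s; rewrite inE ltnS.
  by rewrite card_face_le andbT.
elim: m.+1 => [|n IH].
  by rewrite big_ord0 boundary_rank0 // => s; rewrite !inE andbF.
rewrite big_ord_recr /= -IH.
have -> : K_ n.+1 = K_ n :|: simplices K (n%:Z - 1).
  apply/setP=> s; rewrite !inE -andb_orr /face_dim; congr (_ && _).
  by move: #|_| => k; lia.
apply: (@boundary_rankU _ _ [set t : face | (#|t|.+1 < n)%N]
  [set t : face | #|t|.+1 == n]).
- rewrite -setI_eq0; apply/eqP/setP=> s; rewrite !inE /face_dim;
  move: #|_| => k; case: (s \in K) => //=; lia.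
- by rewrite -setI_eq0; apply/eqP/setP=> s; rewrite !inE; move: #|_| => k; lia.
- by move=> s u; rewrite !inE (cardsD1 u s) => /andP[_ +] us; rewrite us;
  move: #|_| => k; lia.
- by move=> s u; rewrite !inE /face_dim (cardsD1 u s) => /andP[_ +] us; rewrite us;
  move: #|_| => k; lia.
Qed.

(** Each boundary rank is subtracted twice: in its source degree, where it reduces the cycles, and
    in its target degree, where it counts the boundaries. *)
Lemma total_betti_rank K : downset K -> (total_betti F K + (rho K).*2)%N = #|K|.
Proof.
move=> dK; have -> : #|K| = (\sum_(k < m.+1) #|simplices K (k%:Z - 1)|)%N.
  rewrite -sum1_card (partition_big (fun s => inord #|s| : 'I_m.+1) xpredT) //=.
  apply: eq_bigr => k _; rewrite -sum1_card; apply: eq_bigl => s.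
  rewrite inE /face_dim -val_eqE /= inordK; first by congr (_ && _); lia.
  by rewrite ltnS card_face_le.
under [RHS]eq_bigr do rewrite -reduced_betti_rank //.
rewrite !big_split /= -/(total_betti F K) -boundary_rank_graded // -addnA -addnn.
congr (_ + (_ + _))%N.
under [RHS]eq_bigr do rewrite subrK.
(* Both ends of the shifted sum vanish: there are no faces of dimension [m], and the empty face has
   zero boundary. *)
have e : (\sum_(k < m.+2) rho (simplices K (k%:Z - 1)) = rho K)%N.
  rewrite big_ord_recr /= -boundary_rank_graded //.
  rewrite [X in (_ + X)%N]boundary_rank0 ?addn0 // => s.
  rewrite inE /face_dim => /andP[_ sm]; have := card_face_le s.
  by move: #|_| sm => k; lia.
rewrite -e big_ord_recl [X in (X + _)%N]boundary_rank0 ?add0n /=; last first.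
  move=> s; rewrite inE /face_dim => /andP[_ sm]; apply/eqP; rewrite -cards_eq0.
  by move: #|_| sm => k /=; lia.
by apply: eq_bigr => k _; congr (rho (simplices K _)); rewrite /bump /=; lia.
Qed.

End BoundaryRank.

(** * Links and deletions *)

Section LinkDeletion.

Variables (F : fieldType) (m : nat).
Local Notation face := {set 'I_m}.
Implicit Types (s t : face) (u v : 'I_m) (K X Y : {set face}).

Local Notation B := (boundary_matrix F m).
Local Notation D := (@face_proj F m).
Local Notation C := (cone_matrix F).
Local Notation rho := (@boundary_rank F m).

(** The open star: its faces form a basis of the chains of [K] modulo those of the deletion. *)
Definition star K v := [set s in K | v \in s].

Lemma downset_deletion K v : downset K -> downset (deletion K v).
Proof.
move=> dK s t; rewrite !inE => /andP[sK vs] ts; rewrite (dK s) //=.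
by apply: contra vs => /(subsetP ts).
Qed.

Lemma downset_link K v : downset K -> downset (link K v).
Proof.
move=> dK s t; rewrite !inE => /andP[vs sK] ts; rewrite (dK _ _ sK) ?setUS ?andbT //.
by apply: contra vs => /(subsetP ts).
Qed.

Lemma deletion_star_disjoint K v : [disjoint deletion K v & star K v].
Proof.
rewrite -setI_eq0; apply/eqP/setP=> s; rewrite !inE.
by case: (v \in s); rewrite !andbF.
Qed.

Lemma deletionU_star K v : deletion K v :|: star K v = K.
Proof. by apply/setP=> s; rewrite !inE -andb_orr orNb andbT. Qed.

Lemma deletion_sub K v : deletion K v \subset K.
Proof. by apply/subsetP=> s; rewrite inE => /andP[]. Qed.

Lemma card_link K v : #|link K v| = #|star K v|.
Proof.
have inj : {in link K v &, injective (fun s => v |: s)}.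
  move=> s t; rewrite !inE => /andP[vs _] /andP[vt _] e.
  by rewrite -(setU1K vs) e setU1K.
rewrite -(card_in_imset inj); apply: eq_card => t.
apply/imsetP/idP => [[s + ->]|]; rewrite inE.
  by case/andP=> vs sK; rewrite inE sK setU11.
by case/andP=> tK vt; exists (t :\ v); rewrite ?setD1K // inE setD11 setD1K.
Qed.

Lemma card_deletion_link K v : (#|deletion K v| + #|link K v|)%N = #|K|.
Proof.
rewrite card_link -[in RHS](deletionU_star K v) cardsU disjoint_setI0 ?cards0 ?subn0 //.
exact: deletion_star_disjoint.
Qed.

Lemma trmx_cone v :
  (C v)^T = face_matrix (fun s t => ((v \notin t) && (s == v |: t))%:R * del_sign F s v).
Proof. by apply/matrixP=> a b; rewrite !mxE. Qed.

Lemma cone_trmx_cone v : C v *m (C v)^T = D [set s : face | v \notin s].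
Proof.
rewrite trmx_cone mul_face_matrix; apply: eq_face_matrix => s t; rewrite inE.
rewrite (bigD1 (v |: s)) //= big1 ?addr0 => [|r /negPf->]; last first.
  by rewrite andbF !mul0r.
rewrite eqxx andbT.
case: (boolP (v \in s)) => vs; first by rewrite andbF !mul0r.
have -> : (v \notin t) && (v |: s == v |: t) = (s == t).
  apply/andP/eqP => [[vt /eqP e]|<- //]; by rewrite -(setU1K vs) e setU1K.
by rewrite andbT mul1r mulrCA del_sign_sqr mulr1.
Qed.

Lemma trmx_cone_cone v : (C v)^T *m C v = D [set s : face | v \in s].
Proof.
rewrite trmx_cone mul_face_matrix; apply: eq_face_matrix => s t; rewrite inE.
rewrite (bigD1 (s :\ v)) //= big1 ?addr0 ?setD11 => [|r nr]; last first.
  case: (boolP (v \in r)) => vr; rewrite /= ?mul0r //.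
  case: (s =P v |: r) nr => [->|]; last by rewrite !mul0r.
  by rewrite setU1K // eqxx.
case: (boolP (v \in s)) => vs; last first.
  by rewrite andbF; case: eqP => [e|]; [rewrite e setU11 in vs | rewrite !mul0r].
rewrite setD1K // eqxx mul1r andbT eq_sym.
by case: eqP => [->|_]; rewrite ?mul0r ?mulr0 // mul1r del_sign_sqr.
Qed.

Lemma link_cone_star K v : D (link K v) *m C v = C v *m D (star K v).
Proof.
rewrite mul_projl mul_projr; apply: eq_face_matrix => s t; rewrite !inE.
case: (boolP (v \in s)) => vs; first by rewrite !mul0r.
case: eqP => [->|_]; last by rewrite !mul0r mulr0.
by rewrite setU11 !andbT mulrC.
Qed.

(* Coning with v turns the chains of the link into the chains of K modulo
   those of the deletion. *)
Lemma rank_star_boundary K v : downset K ->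
  \rank (D K *m B *m D (star K v)) = rho (link K v).
Proof.
move=> dK; set L := link K v; set S := star K v.
have dL : downset L by apply: downset_link.
have -> : D K *m B *m D S = D S *m B *m D S.
  have e := deletionU_star K v; rewrite -{1}e face_projU ?deletion_star_disjoint //.
  rewrite mulmxDl mulmxDl boundary_projC ?add0r // => s u.
  by rewrite !inE => /andP[_ /negPf->] us; rewrite !andbF.
have LS : D L *m D S = 0.
  rewrite face_proj_disjoint // -setI_eq0; apply/eqP/setP=> s; rewrite !inE.
  by case: (v \in s); rewrite ?andbF.
(* The cone operator anticommutes with the boundary up to the identity, and the identity term dies
   because no face of the link contains [v]. *)
have e : C v *m (D S *m B *m D S) = - (D L *m B *m C v).
  rewrite !mulmxA -link_cone_star -/L -(mulmxA (D L)).
  have -> : C v *m B = 1%:M - B *m C v by rewrite -(cone_homotopy F v) addrK.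
  rewrite mulmxBr mulmx1 mulmxBl LS sub0r; congr (- _).
  rewrite -(downset_proj F dL) !mulmxA.
  by rewrite -(mulmxA _ (D L) (C v)) link_cone_star -/S -!mulmxA.
(* The transpose of the cone operator inverts it between chains avoiding [v] and chains through [v],
   so no rank is lost. *)
have eL : rho L = \rank (C v *m (D S *m B *m D S)).
  rewrite e mxrank_opp; apply/eqP; rewrite eqn_leq mxrankM_maxl andbT /boundary_rank.
  have {1}-> : D L *m B = D L *m B *m C v *m (C v)^T.
    rewrite -mulmxA cone_trmx_cone boundary_proj // => s u.
    by rewrite !inE => /andP[vs _] us; rewrite (negPf vs) andbF.
  exact: mxrankM_maxl.
apply/eqP; rewrite eL eqn_leq mxrankM_maxr andbT.
have {1}-> : D S *m B *m D S = (C v)^T *m (C v *m (D S *m B *m D S)).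
  rewrite [RHS]mulmxA trmx_cone_cone 2![in RHS]mulmxA face_projM; congr (D _ *m _ *m _).
  by apply/setP=> s; rewrite !inE; case: (v \in s); rewrite ?andbF.
exact: mxrankM_maxr.
Qed.

(** Rank-nullity for the projection of the boundaries of [K] to the star; the kernel consists of the
    boundaries supported in the deletion. *)
Lemma boundary_rank_star K v : downset K ->
  rho K = (rho (link K v) + \rank (D K *m B :&: kermx (D (star K v))))%N.
Proof. by move=> dK; rewrite -rank_star_boundary // mxrank_mul_ker. Qed.

Lemma boundary_in_deletion K v : downset K ->
  (D K *m B :&: kermx (D (star K v)) <= D (deletion K v) :&: kermx B)%MS.
Proof.
move=> dK; rewrite sub_capmx; apply/andP; split; last first.
  apply/sub_kermxP; have /submxP[W ->] := capmxSl (D K *m B) (kermx (D (star K v))).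
  by rewrite -!mulmxA boundary_sqr0 !mulmx0.
set A := (_ :&: _)%MS.
have AS : A *m D (star K v) = 0 by apply/sub_kermxP/capmxSr.
have AK : A *m D K = A.
  apply: sub_face_proj_id; apply: submx_trans (capmxSl _ _) _.
  by rewrite -downset_proj // submxMl.
have e : D K = D (deletion K v) + D (star K v).
  by rewrite -face_projU ?deletion_star_disjoint // deletionU_star.
by rewrite -AK e mulmxDr AS addr0 submxMl.
Qed.

(** Boundaries of [K] supported in the deletion are cycles there, and those cycles have dimension
    [#|deletion K v| - rho (deletion K v)]. *)
Lemma boundary_rank_link_le K v : downset K ->
  (rho K + rho (deletion K v) <= rho (link K v) + #|deletion K v|)%N.
Proof.
move=> dK; have := mxrankS (boundary_in_deletion v dK).
have := boundary_rank_kernel F (deletion K v).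
have := boundary_rank_star v dK; lia.
Qed.

Lemma boundary_rank_link_eq K v : downset K ->
    (rho K + rho (deletion K v) = rho (link K v) + #|deletion K v|)%N ->
  (D (deletion K v) :&: kermx B <= D K *m B)%MS.
Proof.
move=> dK e; apply: submx_trans (capmxSl _ (kermx (D (star K v)))).
rewrite -(mxrank_leqif_sup (boundary_in_deletion v dK)).2.
have := boundary_rank_kernel F (deletion K v).
have := boundary_rank_star v dK; move: e; lia.
Qed.

Lemma boundary_rank_link_ge K v : downset K ->
  (rho (link K v) + rho (deletion K v) <= rho K)%N.
Proof.
move=> dK; rewrite (boundary_rank_star v dK) leq_add2l; apply: mxrankS.
rewrite sub_capmx; apply/andP; split.
  by rewrite -(face_proj_sub F (deletion_sub K v)) -mulmxA submxMl.
apply/sub_kermxP/boundary_projC => s u; rewrite !inE => /andP[_ /negPf->] _.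
by rewrite !andbF.
Qed.

Local Notation h := (@total_betti F m).

Lemma total_betti_link_le K v : downset K ->
  (h (link K v) <= h (deletion K v) + h K)%N.
Proof.
move=> dK; have := boundary_rank_link_le v dK.
have := total_betti_rank F dK; have := total_betti_rank F (downset_link (v := v) dK).
have := total_betti_rank F (downset_deletion (v := v) dK).
have := card_deletion_link K v; lia.
Qed.

Lemma total_betti_link_eq K v : downset K ->
    h (link K v) = (h (deletion K v) + h K)%N ->
  (D (deletion K v) :&: kermx B <= D K *m B)%MS.
Proof.
move=> dK e; apply: boundary_rank_link_eq => //.
have := total_betti_rank F dK; have := total_betti_rank F (downset_link (v := v) dK).
have := total_betti_rank F (downset_deletion (v := v) dK).
have := card_deletion_link K v; move: e; lia.
Qed.

Lemma total_betti_le K v : downset K ->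
  (h K <= h (deletion K v) + h (link K v))%N.
Proof.
move=> dK; have := boundary_rank_link_ge v dK.
have := total_betti_rank F dK; have := total_betti_rank F (downset_link (v := v) dK).
have := total_betti_rank F (downset_deletion (v := v) dK).
have := card_deletion_link K v; lia.
Qed.

(** The cone over a chain of [K] stays in [K], so by the homotopy every cycle bounds its own
    cone. *)
Lemma total_betti_cone K v : downset K ->
  (forall s, s \in K -> v |: s \in K) -> h K = 0%N.
Proof.
move=> dK coneK; have := total_betti_rank F dK.
suff : (\rank (D K :&: kermx B) <= rho K)%N.
  by have := boundary_rank_kernel F K; lia.
apply: mxrankS; set Z := (_ :&: _)%MS.
have ZB : Z *m B = 0 by apply/sub_kermxP/capmxSr.
have ZK : Z *m D K = Z by apply/sub_face_proj_id/capmxSl.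
rewrite -[Z]mulmx1 -(cone_homotopy F v) mulmxDr [Z *m (B *m _)]mulmxA ZB mul0mx addr0.
rewrite -ZK; have -> : Z *m D K *m (C v *m B) = Z *m (D K *m C v *m B).
  by rewrite !mulmxA.
have -> : D K *m C v = D K *m C v *m D K.
  rewrite mul_projl mul_projr; apply: eq_face_matrix => s t.
  case: (boolP (s \in K)) => sK; rewrite ?mul0r //.
  by case: andP => [[_ /eqP->]|_]; rewrite ?mul0r ?mulr0 ?mul0r // coneK // mulr1.
by rewrite -(mulmxA (_ *m C v)) mulmxA submxMl.
Qed.

Lemma total_betti_set0 : h [set set0] = 1%N.
Proof.
have d0 : downset [set (set0 : face)].
  by move=> s t; rewrite !inE => /eqP->; rewrite subset0.
have := total_betti_rank F d0; rewrite cards1; lia.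
Qed.

(* The boundary of the missing simplex N is a cycle of the deletion of v, hence
   bounds in K, and the faces v * (N - u) are the only ones that can fill it. *)
Lemma filled_nonface K v (N : face) u : downset K ->
    h (link K v) = (h (deletion K v) + h K)%N ->
    N \notin K -> v \notin N -> u \in N ->
    (forall w, w \in N -> N :\ w \in K) ->
    (forall s, s \in K -> s \subset v |: N) ->
  v |: N :\ u \in K.
Proof.
move=> dK e NK vN uN facetN subN.
have bd s w : s \in [set N] -> w \in s -> s :\ w \in deletion K v.
  rewrite inE => /eqP-> wN; rewrite inE facetN //=.
  by apply: contra vN => /setD1P[].
(* Row [N] of [W] is a chain of [K] with the same boundary as [N]; the coefficients of [N :\ u] are
   compared below. *)
have /submxP[W eW] := submx_trans (cycle_proj F bd) (total_betti_link_eq dK e).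
have WE : W = face_matrix (fun s t => W (enum_rank s) (enum_rank t)).
  by apply/matrixP=> a b; rewrite !mxE !enum_valK.
move: eW; rewrite WE !mul_projl mul_face_matrix => /face_matrix_inj/(_ N (N :\ u)).
rewrite inE eqxx mul1r => eN; apply/negPn/negP => nK.
have /negP[] := incidenceD1_neq0 F uN; rewrite eN big1 // => r _.
case: (boolP (r \in K)) => rK; last by rewrite mul0r mulr0.
have [->|/incidence_neq0[w wr eNr]] := eqVneq (incidence F r (N :\ u)) 0.
  by rewrite !mulr0.
(* Only [w = v] and [w = u] are possible: the first gives the desired face, the second gives the
   non-face [N]. *)
have er : r = w |: N :\ u by rewrite eNr setD1K.
have := subsetP (subN r rK) w wr; rewrite !inE => /orP[/eqP wv|wN].
  by rewrite -wv -er rK in nK.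
have : w \notin N :\ u by rewrite eNr setD11.
rewrite !inE wN andbT negbK => /eqP wu.
by rewrite er wu setD1K // (negPf NK) in rK.
Qed.

End LinkDeletion.

(** * Minimal non-faces *)

Section MinimalNonfaces.

Variable m : nat.
Local Notation face := {set 'I_m}.
Implicit Types (s t J N T : face) (u v : 'I_m) (K : {set face}).
Local Notation MN := (@minimal_nonfaces m).

Lemma minimal_nonfaceP K N : set0 \in K ->
  reflect (N \notin K /\ forall v, v \in N -> N :\ v \in K) (N \in MN K).
Proof.
move=> K0; rewrite inE; apply: (iffP and3P) => [[_ NK /forall_inP]|[NK fN]] //.
by split=> //; [apply: contraNneq NK => -> | apply/forall_inP].
Qed.

Lemma minimal_nonface_sub K s : set0 \in K -> s \notin K ->
  exists2 N, N \in MN K & N \subset s.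
Proof.
move=> K0 sK; have [N /minsetP[NK minN] Ns] := @minset_exists _ (fun t => t \notin K) s sK.
exists N => //; apply/minimal_nonfaceP => //; split=> // v vN.
apply/negPn/negP => NvK; have /setP/(_ v) := minN _ NvK (subD1set _ _).
by rewrite setD11 vN.
Qed.

Lemma minimal_nonface_antichain K N N' : downset K ->
  N \in MN K -> N' \in MN K -> N \subset N' -> N = N'.
Proof.
move=> dK; rewrite !inE => /and3P[_ NK _] /and3P[_ _ /forall_inP fN'] NN'.
apply/eqP; rewrite eqEsubset NN'; apply/subsetP=> u uN'; apply/negPn/negP => uN.
case/negP: NK; apply: dK (fN' u uN') _.
by rewrite subsetD1 NN'.
Qed.

(** The field-free form of Taylor minimality: no monomial in the differential is 1. *)
Definition has_private_vertices K :=
  forall N, N \in MN K ->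
    exists2 v, v \in N & forall N', N' \in MN K -> v \in N' -> N' = N.

(** [T] fixes a choice of private vertices. Unlike their mere existence, this records which
    vertices, namely those outside [T], can be linked without destroying the choice. *)
Definition transversal_of K T :=
  (forall N, N \in MN K -> exists v, N :&: T = [set v]) /\
  {in MN K &, injective (fun N => N :&: T)}.

Lemma transversal_of_private K T : transversal_of K T -> has_private_vertices K.
Proof.
move=> [trT injT] N NK; have [v eN] := trT N NK.
have /setIP[vN vT] : v \in N :&: T by rewrite eN set11.
exists v => // N' N'K vN'; apply: injT => //; rewrite eN.
have [w eN'] := trT N' N'K; have : v \in N' :&: T by rewrite inE vN'.
by rewrite eN' inE => /eqP->.
Qed.

Lemma facet_nonface K s v : downset K -> set0 \in K ->
    s \in facets K -> v \notin s ->
  exists2 N, N \in MN K & N :&: ~: s = [set v].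
Proof.
move=> dK K0; rewrite inE => /maxsetP[sK maxs] vs.
have [|N NK Nvs] := @minimal_nonface_sub K (v |: s) K0.
  apply/negP=> vsK; have /setP/(_ v) := maxs _ vsK (subsetUr _ _).
  by rewrite setU11 (negPf vs).
exists N => //; apply/eqP; rewrite eqEsubset; apply/andP; split.
  apply/subsetP=> u; rewrite !inE => /andP[/(subsetP Nvs)].
  by rewrite !inE => /orP[//|->].
rewrite sub1set !inE vs andbT; apply/negPn/negP => vN.
move: NK; rewrite inE => /and3P[_ /negP NnK _]; apply/NnK/(dK s) => //.
apply/subsetP=> u uN; have := subsetP Nvs u uN; rewrite !inE.
by case/orP => // /eqP uv; rewrite -uv uN in vN.
Qed.

(** Each vertex outside [s] selects a minimal non-face, from which it is recovered as the trace
    outside [s]. Under equality the selection is onto, so every minimal non-face has such a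
    trace. *)
Lemma card_facet K s : downset K -> set0 \in K -> s \in facets K ->
  (#|~: s| <= #|MN K|)%N /\ (#|~: s| = #|MN K| -> transversal_of K (~: s)).
Proof.
move=> dK K0 fs.
pose g v := odflt set0 [pick N in MN K | N :&: ~: s == [set v]].
have gP v : v \in ~: s -> g v \in MN K /\ g v :&: ~: s = [set v].
  rewrite inE => /(facet_nonface dK K0 fs)[N NK eN]; rewrite /g.
  case: pickP => [N' /andP[? /eqP]|/(_ N)] //=.
  by rewrite NK eN eqxx.
have ginj : {in ~: s &, injective g}.
  move=> u v /gP[_ eu] /gP[_ ev] e; apply: set1_inj.
  by rewrite -eu e.
have gsub : g @: (~: s) \subset MN K by apply/subsetP=> _ /imsetP[v /gP[? _] ->].
rewrite -(card_in_imset ginj); split; first exact: subset_leq_card.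
move=> e; have eg : g @: (~: s) = MN K by apply/eqP; rewrite eqEcard gsub e leqnn.
split=> [N|N N']; rewrite -eg => /imsetP[u us ->].
  by exists u; case: (gP u us).
case/imsetP=> v vs ->; case: (gP u us) (gP v vs) => _ -> [_ ->].
by move=> /set1_inj->.
Qed.

Lemma private_facet K : downset K -> set0 \in K -> has_private_vertices K ->
  exists2 s, s \in facets K & #|~: s| = #|MN K|.
Proof.
move=> dK K0 pK.
(* [Q] collects the private vertices. Its complement contains no minimal non-face, hence is a face,
   and a facet above it misses only private vertices. *)
pose Q := [set v | [exists N in MN K,
  (v \in N) && [forall (N' | N' \in MN K), (v \in N') ==> (N' == N)]]].
have QP v N N' : v \in Q -> N \in MN K -> N' \in MN K -> v \in N -> v \in N' -> N = N'.
  rewrite inE => /exists_inP[N1 _ /andP[_ /forall_inP pv]] NK N'K vN vN'.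
  by have /implyP/(_ vN)/eqP-> := pv N NK; have /implyP/(_ vN')/eqP-> := pv N' N'K.
have QK : ~: Q \in K.
  apply/negPn/negP => /(minimal_nonface_sub K0)[N NK NQ].
  have [v vN pv] := pK N NK; have := subsetP NQ v vN; rewrite !inE => /negP[].
  apply/exists_inP; exists N => //; rewrite vN; apply/forall_inP => N' N'K.
  by apply/implyP => /pv->.
have [s maxs Qs] := @maxset_exists _ (fun t => t \in K) _ QK.
have fs : s \in facets K by rewrite inE.
have sK : s \in K by case/maxsetP: maxs.
exists s => //; apply/eqP; rewrite eqn_leq (card_facet dK K0 fs).1 /=.
(* Sending a vertex outside [s] to its only minimal non-face is onto, since no non-face lies inside
   [s]. *)
pose g v := odflt set0 [pick N in MN K | v \in N].
apply: leq_trans (leq_imset_card g _); apply/subset_leq_card/subsetP => N NK.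
have : ~~ (N \subset s).
  apply/negP => Ns; move: NK; rewrite inE => /and3P[_ /negP NnK _].
  exact/NnK/(dK s).
case/subsetPn => v vN vs; apply/imsetP; exists v; first by rewrite inE.
have vQ : v \in Q.
  by apply/negPn/negP => vQ; case/negP: vs; apply: (subsetP Qs); rewrite inE.
rewrite /g; case: pickP => [N' /andP[N'K vN']|/(_ N)] /=; first exact: (QP v).
by rewrite NK vN.
Qed.

(** The singleton of [v] is a non-face of the link; any other [M] avoids [v], and a minimal non-face
    of [K] inside [v |: M] must give all of [M]. *)
Lemma minimal_nonface_link K v M : downset K -> set0 \in K -> [set v] \in K ->
    M \in MN (link K v) -> M = [set v] \/ exists2 N, N \in MN K & M = N :\ v.
Proof.
move=> dK K0 vK ML; have dL := downset_link (v := v) dK.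
have L0 : set0 \in link K v by rewrite !inE setU0 vK.
have vL : [set v] \notin link K v by rewrite inE set11.
have [vM|vM] := boolP (v \in M).
  have [N NL Nv] := minimal_nonface_sub L0 vL.
  left; rewrite -(minimal_nonface_antichain dL NL ML); last first.
    by apply: subset_trans Nv _; rewrite sub1set.
  apply/eqP; rewrite eqEsubset Nv sub1set /=; apply/negPn/negP => vN.
  have := NL; rewrite inE => /and3P[/set0Pn[w wN] _ _].
  by have := subsetP Nv w wN; rewrite inE => /eqP wv; rewrite wv (negPf vN) in wN.
right; have vMK : v |: M \notin K.
  by have /(minimal_nonfaceP _ L0)[] := ML; rewrite inE vM.
have [N NK NvM] := minimal_nonface_sub K0 vMK; exists N => //.
have NL : N :\ v \notin link K v.
  rewrite inE setD11 /=; have /(minimal_nonfaceP _ K0)[] := NK.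
  move=> /negP NnK _; apply/negP => /dK H.
  by apply/NnK/H/subsetP => w wN; rewrite !inE wN andbT orbN.
have [N1 N1L N1N] := minimal_nonface_sub L0 NL.
have NM : N :\ v \subset M by rewrite subDset.
have N1M := minimal_nonface_antichain dL N1L ML (subset_trans N1N NM).
by apply/eqP; rewrite eqEsubset NM andbT -N1M.
Qed.

Lemma transversal_link K T v : downset K -> set0 \in K -> [set v] \in K ->
  v \notin T -> transversal_of K T -> transversal_of (link K v) (v |: T).
Proof.
move=> dK K0 vK vT [trT injT].
have tr1 : [set v] :&: (v |: T) = [set v] by apply/setIidPl; rewrite sub1set setU11.
have trN N : (N :\ v) :&: (v |: T) = N :&: T.
  apply/setP=> w; rewrite !inE; case: (w =P v) => [->|_] //=.
  by rewrite (negPf vT) andbF.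
split=> [M|M M'].
  move=> /(minimal_nonface_link dK K0 vK)[->|[N NK ->]]; first by exists v.
  by rewrite trN; apply: trT.
have neq N : [set v] <> N :&: T.
  by move=> /setP/(_ v); rewrite !inE eqxx (negPf vT) andbF.
move=> /(minimal_nonface_link dK K0 vK) eM /(minimal_nonface_link dK K0 vK) eM'.
case: eM eM' => [->|[N NK ->]] [->|[N' N'K ->]] //; rewrite ?tr1 ?trN //.
- by move=> /neq.
- by move=> /esym/neq.
by move=> /(injT _ _ NK N'K)->.
Qed.

(** Removing [v] embeds the old minimal non-faces; [fill] keeps those missing [v] minimal. The ghost
    [[set v]] is new, hence the strict inequality. *)
Lemma card_minimal_nonfaces_link K v : downset K -> set0 \in K -> [set v] \in K ->
    (forall N u, N \in MN K -> v \notin N -> u \in N -> v |: N :\ u \in K) ->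
  (#|MN K| < #|MN (link K v)|)%N.
Proof.
move=> dK K0 vK fill.
have L0 : set0 \in link K v by rewrite !inE setU0 vK.
pose f N := N :\ v.
have finj : {in MN K &, injective f}.
  move=> N N' NK N'K e.
  (* Sets that agree away from [v] are comparable, and minimal non-faces form an antichain. *)
  suff : (N \subset N') || (N' \subset N).
    by case/orP => /(minimal_nonface_antichain dK) H; [apply: H|apply/esym/H].
  have sub A : f A \subset A by apply: subD1set.
  have [vN|vN] := boolP (v \in N); last first.
    have <- : f N = N by apply/setDidPl; rewrite disjoint_sym disjoints1.
    by rewrite e sub.
  have [vN'|vN'] := boolP (v \in N'); last first.
    have <- : f N' = N' by apply/setDidPl; rewrite disjoint_sym disjoints1.
    by rewrite -e sub orbT.
  by rewrite -(setD1K vN) -(setD1K vN') -/(f N) -/(f N') e subxx.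
rewrite -(card_in_imset finj) -add1n.
have vf : [set v] \notin f @: MN K.
  by apply/imsetP => [[N _ /setP/(_ v)]]; rewrite setD11 set11.
suff <- : #|[set v] |: f @: MN K| = (1 + #|f @: MN K|)%N.
  apply/subset_leq_card/subsetP => M /setU1P[->|/imsetP[N NK ->]].
    apply/minimal_nonfaceP => //; split; first by rewrite inE set11.
    by move=> w /set1P->; rewrite setDv.
  have /(minimal_nonfaceP _ K0)[NnK fN] := NK.
  apply/minimal_nonfaceP => //; split.
    rewrite inE setD11 /=; apply: contra NnK => /dK; apply.
    by apply/subsetP => w wN; rewrite !inE wN andbT orbN.
  move=> w /setD1P[wv wN].
  rewrite inE in_setD1 setD11 andbF /=.
  have [vN|vN] := boolP (v \in N).
    have -> : f N :\ w = (N :\ w) :\ v by rewrite /f !setDDl setUC.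
    by rewrite setD1K ?fN // in_setD1 eq_sym wv.
  rewrite [f N](_ : _ = N) ?fill //.
  by apply/setDidPl; rewrite disjoint_sym disjoints1.
by rewrite cardsU1 vf.
Qed.

End MinimalNonfaces.

(** * The total dimension of Tor *)

Section TotalTor.

Variables (F : fieldType) (m : nat).
Local Notation face := {set 'I_m}.
Implicit Types (s t J N T : face) (u v : 'I_m) (K : {set face}).
Local Notation MN := (@minimal_nonfaces m).
Local Notation h := (@total_betti F m).
Local Notation full := (@full_subcomplex m).

Lemma downset_full K J : downset K -> downset (full K J).
Proof.
move=> dK s t; rewrite !inE => /andP[sK sJ] ts.
by rewrite (dK s) // (subset_trans ts).
Qed.

Lemma deletion_full K J v : deletion (full K J) v = full K (J :\ v).
Proof. by apply/setP=> s; rewrite !inE subsetD1 andbA. Qed.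

Lemma link_full K J v : v \in J -> link (full K J) v = full (link K v) (J :\ v).
Proof.
move=> vJ; apply/setP=> s; rewrite !inE subUset sub1set vJ subsetD1 /=.
by case: (v \in s); rewrite /= ?andbF ?andbT.
Qed.

Lemma full_link_setU1 K J v : full (link K v) (v |: J) = full (link K v) J.
Proof.
apply/setP=> s; rewrite !inE; case: (boolP (v \in s)) => //= vs.
rewrite -subDset.
by have /setDidPl-> : [disjoint s & [set v]] by rewrite disjoint_sym disjoints1.
Qed.

Lemma sum_sets_setU1 v (f : face -> nat) :
  (\sum_J f J = \sum_(J : face | v \notin J) (f J + f (v |: J)))%N.
Proof.
rewrite (bigID (fun J : face => v \notin J)) big_split; congr (_ + _)%N.
rewrite (reindex_onto (fun J => v |: J) (fun J => J :\ v)) /=; last first.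
  by move=> J; rewrite negbK => vJ; rewrite setD1K.
apply: eq_bigl => J; rewrite negbK setU11 /=; apply/eqP/idP => [<-|/setU1K//].
by rewrite setD11.
Qed.

Lemma total_betti_full_link K J v : downset K -> v \notin J ->
  (h (full (link K v) J) <= h (full K J) + h (full K (v |: J)))%N.
Proof.
move=> dK vJ; have := total_betti_link_le F v (downset_full (J := v |: J) dK).
by rewrite deletion_full link_full ?setU11 // setU1K.
Qed.

(** The factor 2 comes from the ghost vertex: [J] and [v |: J] induce the same subcomplex of the
    link. *)
Lemma Dtilde_linkE K v :
  Dtilde F (link K v) = (2 * \sum_(J : face | v \notin J) h (full (link K v) J))%N.
Proof.
rewrite big_distrr /Dtilde (sum_sets_setU1 v); apply: eq_bigr => J _ /=.
by rewrite full_link_setU1 addnn -mul2n.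
Qed.

Lemma Dtilde_link_le K v : downset K -> (Dtilde F (link K v) <= 2 * Dtilde F K)%N.
Proof.
move=> dK; rewrite Dtilde_linkE leq_mul2l /Dtilde (sum_sets_setU1 v) leq_sum // => J vJ.
exact: total_betti_full_link.
Qed.

Lemma Dtilde_link_eq K v J : downset K -> Dtilde F (link K v) = (2 * Dtilde F K)%N ->
    v \notin J ->
  h (full (link K v) J) = (h (full K J) + h (full K (v |: J)))%N.
Proof.
move=> dK; rewrite Dtilde_linkE => /eqP; rewrite eqn_mul2l /= /Dtilde (sum_sets_setU1 v).
have /leqif_sum : forall J : face, v \notin J ->
    (h (full (link K v) J) <= h (full K J) + h (full K (v |: J))
      ?= iff (h (full (link K v) J) == h (full K J) + h (full K (v |: J))))%N.
  by move=> J' vJ'; split; first exact: total_betti_full_link.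
move=> [_ ->] /forall_inP all_eq vJ; exact/eqP/all_eq.
Qed.

Lemma facet_link K s v : s \in facets K -> v \in s -> s :\ v \in facets (link K v).
Proof.
rewrite !inE => /maxsetP[sK maxs] vs; apply/maxsetP.
rewrite !inE eqxx setD1K //; split=> // t; rewrite inE => /andP[vt tK] st.
by rewrite -(maxs _ tK) ?setU1K // -(setD1K vs) setUS.
Qed.

Lemma facet_set0 K : downset K -> set0 \in facets K -> K = [set set0].
Proof.
move=> dK; rewrite inE => /maxsetP[K0 max0]; apply/setP=> s; rewrite inE.
by apply/idP/eqP => [sK|-> //]; rewrite (max0 s) ?sub0set.
Qed.

Lemma Dtilde_set0 : Dtilde F [set (set0 : face)] = (2 ^ m)%N.
Proof.
transitivity (\sum_(J : face) 1)%N; last first.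
  by rewrite sum1_card -cardsT -powersetT card_powerset cardsT card_ord.
apply: eq_bigr => J _; rewrite -/(h (full [set set0] J)) -(total_betti_set0 F m).
congr h; apply/setP=> s; rewrite !inE; case: eqP => // ->; exact: sub0set.
Qed.

(** Linking at a vertex of [s] shrinks the facet and costs a factor 2. When it is empty, all
    vertices are ghosts and every [J] contributes 1. *)
Lemma facet_Dtilde_ge K s : downset K -> s \in facets K ->
  (2 ^ m <= 2 ^ #|s| * Dtilde F K)%N.
Proof.
move e: #|s| => n; elim: n => [|n IH] in K s e * => dK fs.
  move: fs; rewrite (cards0_eq e) => /(facet_set0 dK) ->.
  by rewrite Dtilde_set0 mul1n.
have [v vs] : exists v, v \in s by apply/set0Pn; rewrite -card_gt0 e.
have es : #|s :\ v| = n by move: e; rewrite (cardsD1 v) vs => -[].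
apply: leq_trans (IH _ _ es (downset_link dK) (facet_link fs vs)) _.
by rewrite expnSr -mulnA leq_mul2l Dtilde_link_le ?orbT.
Qed.

Lemma taut_card_minimal_nonfaces K s : downset K -> s \in facets K ->
    (2 ^ #|s| * Dtilde F K)%N = (2 ^ m)%N ->
  (#|MN K| + #|s| <= m)%N.
Proof.
move e: #|s| => n; elim: n => [|n IH] in K s e * => dK fs eD.
  move: fs; rewrite (cards0_eq e) => /(facet_set0 dK) eK.
  (* Here only the empty face remains, so every minimal non-face is a singleton. *)
  rewrite addn0 -[X in (_ <= X)%N]card_ord -(card_imset predT (@set1_inj 'I_m)).
  apply/subset_leq_card/subsetP => N; rewrite eK inE => /and3P[/set0Pn[v vN] _].
  move=> /forall_inP/(_ v vN); rewrite inE => /eqP e0; apply/imsetP; exists v => //.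
  by rewrite -(setD1K vN) e0 setU0.
have [v vs] : exists v, v \in s by apply/set0Pn; rewrite -card_gt0 e.
have es : #|s :\ v| = n by move: e; rewrite (cardsD1 v) vs => -[].
have sK : s \in K by move: fs; rewrite inE => /maxsetP[].
have K0 : set0 \in K by apply: dK sK (sub0set _).
have vK : [set v] \in K by apply: dK sK _; rewrite sub1set.
have dL := downset_link (v := v) dK; have fL := facet_link fs vs.
have geL := facet_Dtilde_ge dL fL; have leL := Dtilde_link_le v dK.
(* The lower bound for the link already equals the upper bound coming from [K], so no inequality in
   the descent is strict. *)
have eL : Dtilde F (link K v) = (2 * Dtilde F K)%N.
  apply/eqP; rewrite eqn_leq leL -(leq_pmul2l (expn_gt0 2 n)) -es.
  by apply: leq_trans geL; rewrite -eD es expnSr -mulnA.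
have eDL : (2 ^ n * Dtilde F (link K v))%N = (2 ^ m)%N.
  by rewrite eL -eD expnSr -mulnA.
rewrite addnS; apply: leq_trans (IH _ _ es dL fL eDL).
rewrite -addSn leq_add2r; apply: card_minimal_nonfaces_link => // N u NK vN uN.
have /(minimal_nonfaceP _ K0)[NnK fN] := NK.
(* Restricting to [v |: N] leaves no other vertices for a filling of the boundary of [N]. *)
suff : v |: N :\ u \in full K (v |: N) by rewrite inE => /andP[].
apply: (@filled_nonface F) => //.
- exact: downset_full.
- rewrite deletion_full link_full ?setU11 // setU1K //.
  exact: Dtilde_link_eq.
- by rewrite inE (negPf NnK).
- move=> w wN; rewrite inE fN //; apply: subset_trans (subD1set _ _) _.
  exact: subsetUr.
by move=> t; rewrite inE => /andP[].
Qed.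

(** A vertex in no minimal non-face inside [J] is a cone apex of the full subcomplex. *)
Lemma total_betti_uncovered K J v : downset K -> set0 \in K -> v \in J ->
    (forall N, N \in MN K -> N \subset J -> v \notin N) ->
  h (full K J) = 0%N.
Proof.
move=> dK K0 vJ ncov; apply: (@total_betti_cone F m _ v); first exact: downset_full.
move=> s; rewrite !inE subUset sub1set vJ => /andP[sK sJ] /=; rewrite sJ andbT.
apply/negPn/negP => /(minimal_nonface_sub K0)[N NK Nvs].
have NJ : N \subset J by apply: subset_trans Nvs _; rewrite subUset sub1set vJ.
have vN := ncov N NK NJ; move: (NK); rewrite inE => /and3P[_ /negP NnK _].
apply/NnK/(dK s) => //; move: Nvs; rewrite -subDset.
by have /setDidPl-> : [disjoint N & [set v]] by rewrite disjoint_sym disjoints1.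
Qed.

Lemma total_betti_transversal K T J : downset K -> set0 \in K ->
  transversal_of K T -> (h (full K J) <= 1)%N.
Proof.
move e: #|J| => n; elim: n => [|n IH] in K T J e * => dK K0 trT.
  rewrite (cards0_eq e) -(total_betti_set0 F m) leq_eqVlt; apply/orP; left.
  apply/eqP; congr h; apply/setP=> s; rewrite !inE subset0.
  by case: eqP => [->|]; rewrite ?andbT ?andbF.
have [/exists_inP[v vJ /forall_inP ncov]|cov] :=
    boolP [exists v in J, [forall (N | N \in MN K), (N \subset J) ==> (v \notin N)]].
  rewrite (total_betti_uncovered dK K0 vJ) // => N NK NJ.
  exact: implyP (ncov N NK) NJ.
have {}cov v : v \in J -> exists N, [/\ N \in MN K, N \subset J & v \in N].
  move=> vJ; have /forall_inPn[N NK] := exists_inPn cov v vJ.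
  by rewrite negb_imply negbK => /andP[NJ vN]; exists N.
have privT N v : N \in MN K -> N \subset T -> v \in N -> N = [set v].
  move=> NK NT vN; have [w] := trT.1 N NK; rewrite (setIidPl NT) => eN.
  by move: vN; rewrite eN inE => /eqP->.
(* If [J] lies in [T], the minimal non-faces covering it are singletons, so only the empty face
   remains. *)
have [JT|/subsetPn[v vJ vT]] := boolP (J \subset T).
  rewrite -(total_betti_set0 F m) leq_eqVlt; apply/orP; left; apply/eqP; congr h.
  apply/setP=> s; rewrite !inE; apply/andP/eqP => [[sK sJ]|->]; last by rewrite K0 sub0set.
  apply/eqP/set0Pn => -[v vs]; have [N [NK NJ vN]] := cov v (subsetP sJ v vs).
  move: (NK); rewrite inE => /and3P[_ /negP NnK _]; apply/NnK/(dK s) => //.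
  by rewrite (privT N v) // ?sub1set // (subset_trans NJ).
have eJ : #|J :\ v| = n by move: e; rewrite (cardsD1 v) vJ => -[].
have vK : [set v] \in K.
  apply/negPn/negP => /(minimal_nonface_sub K0)[N NK Nv].
  have [w eN] := trT.1 N NK; have : w \in N :&: T by rewrite eN set11.
  by case/setIP => /(subsetP Nv); rewrite inE => /eqP->; rewrite (negPf vT).
apply: leq_trans (total_betti_le F v (downset_full dK)) _.
rewrite deletion_full link_full //.
(* Deleting [v] destroys [N], the only minimal non-face through its private vertex [w]; so the
   deletion is a cone over [w] and only the link contributes. *)
have [N [NK NJ vN]] := cov v vJ; have [w eN] := trT.1 N NK.
have /setIP[wN wT] : w \in N :&: T by rewrite eN set11.
have wJ : w \in J :\ v.
  by rewrite in_setD1 (subsetP NJ) // andbT; apply: contraNneq vT => <-.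
rewrite (total_betti_uncovered dK K0 wJ) ?add0n => [|N' N'K N'J].
  apply: (IH _ (v |: T)) => //; first exact: downset_link.
    by rewrite inE setU0 in_set0.
  exact: transversal_link.
apply/negP => wN'; have eN' : N' = N.
  apply: trT.2 => //; rewrite eN; have [w' ew'] := trT.1 N' N'K.
  have : w \in N' :&: T by rewrite inE wN'.
  by rewrite ew' inE => /eqP->.
by have := subsetP N'J v; rewrite eN' setD11 => /(_ vN).
Qed.

(** Only unions of minimal non-faces contribute, at most 1 each, and [cover] maps the subfamilies
    onto these unions. *)
Lemma transversal_Dtilde_le K T : downset K -> set0 \in K ->
  transversal_of K T -> (Dtilde F K <= 2 ^ #|MN K|)%N.
Proof.
move=> dK K0 trT; rewrite -card_powerset; apply: leq_trans (leq_imset_card cover _).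
rewrite -sum1_card [X in (_ <= X)%N]big_mkcond; apply: leq_sum => J _.
rewrite -/(h (full K J)).
case: ifP => [_|/negP nJ]; first exact: total_betti_transversal trT.
rewrite leqn0; apply/eqP.
have : ~~ (J \subset cover [set N in MN K | N \subset J]).
  apply/negP => sJ; case: nJ; apply/imsetP; exists [set N in MN K | N \subset J].
    by rewrite inE; apply/subsetP => N; rewrite inE => /andP[].
  apply/eqP; rewrite eqEsubset sJ; apply/bigcupsP => N.
  by rewrite inE => /andP[].
case/subsetPn => v vJ vcov; apply: (total_betti_uncovered dK K0 vJ) => N NK NJ.
apply: contra vcov => vN; apply/bigcupP; exists N => //.
by rewrite inE NK.
Qed.

End TotalTor.

(** * Minimal facets, Taylor minimality and the equivalence *)

Lemma mdim_facet (m : nat) (K : {set {set 'I_m}}) : set0 \in K ->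
  exists s, [/\ s \in facets K, mdim K = #|s|%:Z - 1
              & forall t, t \in facets K -> (#|s| <= #|t|)%N].
Proof.
move=> K0; have [s0 maxs0 _] := @maxset_exists _ (fun t => t \in K) _ K0.
have fs0 : s0 \in facets K by rewrite inE.
have le_dim (t : {set 'I_m}) : face_dim t <= m%:Z - 1.
  by rewrite /face_dim lerD2r lez_nat card_face_le.
have [s fs es] := eq_bigmin s0 (fun t => t \in facets K) (@face_dim m) fs0
  (fun t _ => le_dim t).
exists s; split => // t ft; rewrite -lez_nat -(lerD2r (-1)).
rewrite -/(face_dim s) -/(face_dim t) -es; exact: bigmin_le_cond.
Qed.

Lemma meval0_sqfree_monomial (F : fieldType) (m : nat) (N : {set 'I_m}) :
  meval (fun _ => 0 : F) (sqfree_monomial F N) = (N == set0)%:R.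
Proof.
rewrite /sqfree_monomial rmorph_prod /=.
have [->|/set0Pn[v vN]] := eqVneq N set0; first by rewrite big_set0.
by rewrite (bigD1 v) //= mevalXU mul0r.
Qed.

(** The top differential suffices to detect private vertices: its coefficient at [k] is, up to sign,
    the monomial of the vertices of [N_k] in no other [N_j]. Conversely a private vertex survives in
    every smaller subfamily. *)
Lemma taylor_minimalP (F : fieldType) (m : nat) (K : {set {set 'I_m}}) :
  taylor_minimal F K <-> has_private_vertices K.
Proof.
split=> [minT N NK|pK l].
  set r := #|minimal_nonfaces K| in minT *.
  pose k : 'I_r := enum_rank_in NK N.
  have ek : minimal_nonface k = N by rewrite /minimal_nonface enum_rankK_in.
  (* [taylor_diff] at [l] starts in degree [l.+1], so the top one has index [r.-1]; here [r] is
     positive because [N] exists. *)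
  have er : r.-1.+1 = r by rewrite prednK // (leq_trans _ (ltn_ord k)).
  have bA : [set: 'I_r] \in taylor_basis r r.-1.+1 by rewrite inE cardsT card_ord er.
  have bB : [set: 'I_r] :\ k \in taylor_basis r r.-1.
    by rewrite inE cardsDS ?subsetT // cardsT card_ord cards1 subn1.
  have /matrixP/(_ (enum_rank_in bA setT) (enum_rank_in bB (setT :\ k))) := minT r.-1.
  rewrite !mxE !enum_rankK_in // /taylor_coef (big_pred1 k) => [|j]; last first.
    rewrite inE /=; apply/eqP/eqP => [/setP/(_ j)|-> //].
    by rewrite setD11 !inE andbT; case: eqP.
  rewrite rmorphM /= meval0_sqfree_monomial ek => /eqP; rewrite mulf_eq0.
  rewrite /del_sign rmorphXn rmorphN rmorph1 signr_eq0 /=.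
  case: (boolP (_ == set0)) => [_|/set0Pn[v]]; first by rewrite oner_eq0.
  rewrite inE => /andP[vU vN] _; exists v => // N' N'K vN'.
  apply/eqP/negPn/negP => nN; case/negP: vU; apply/bigcupP.
  exists (enum_rank_in NK N'); last by rewrite /minimal_nonface enum_rankK_in.
  rewrite !inE andbT; apply: contra nN => /eqP e.
  by rewrite -[N'](enum_rankK_in NK) // e enum_rankK_in.
apply/matrixP=> a b; rewrite !mxE /taylor_coef rmorph_sum big1 // => k _.
rewrite rmorphM /= meval0_sqfree_monomial.
have [v vN pv] := pK _ (enum_valP k).
case: eqP => [/setP/(_ v)|]; last by rewrite mulr0.
rewrite !inE vN andbT => /negbFE/bigcupP[j /setD1P[njk _] vj].
by case/eqP: njk; apply: enum_val_inj; apply: pv => //; apply: enum_valP.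
Qed.

Lemma weakly_tautE (F : fieldType) (m d : nat) (K : {set {set 'I_m}}) :
  (d <= m)%N -> mdim K = d%:Z - 1 ->
  weakly_taut F K <-> (2 ^ d * Dtilde F K = 2 ^ m)%N.
Proof.
move=> dm ed; rewrite /weakly_taut ed.
have -> : m%:Z - (d%:Z - 1) - 1 = (m - d)%N%:Z by lia.
have -> : (2 ^ m = 2 ^ d * 2 ^ (m - d))%N by rewrite -expnD subnKC.
rewrite -exprnP -natrX.
split=> [/eqP|/eqP]; first by rewrite eqr_nat => /eqP->.
by rewrite eqn_pmul2l ?expn_gt0 // => /eqP->.
Qed.

Theorem theorem1p12 (F : fieldType) (m : nat) (K : {set {set 'I_m}})
    (hK : simplicial_complex K) :
  (weakly_taut F K <-> #|minimal_nonfaces K|%:Z = m%:Z - mdim K - 1) /\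
  (#|minimal_nonfaces K|%:Z = m%:Z - mdim K - 1 <->
     has_minimal_taylor_resolution K).
Proof.
case: hK => K0 _ dK; have [s [fs es mins]] := mdim_facet K0.
have sm := card_face_le s; have [le_r eq_r] := card_facet dK K0 fs.
have card_compl (t : {set 'I_m}) : #|~: t| = (m - #|t|)%N.
  by rewrite cardsCs setCK card_ord.
(* As [s] is a smallest facet, the second condition is the equality case of [card_facet]. *)
have countE : #|minimal_nonfaces K|%:Z = m%:Z - mdim K - 1 <->
    #|~: s| = #|minimal_nonfaces K|.
  by rewrite es card_compl; split; lia.
split; rewrite countE.
  rewrite (weakly_tautE F sm es); split=> [taut|e].
    apply/eqP; rewrite eqn_leq le_r card_compl.
    by have := taut_card_minimal_nonfaces dK fs taut; lia.
  apply/eqP; rewrite eqn_leq facet_Dtilde_ge // andbT.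
  have := transversal_Dtilde_le F dK K0 (eq_r e).
  rewrite -e card_compl -(leq_pmul2l (expn_gt0 2 #|s|)) => /leq_trans; apply.
  by rewrite -expnD subnKC.
split=> [e|[F' /taylor_minimalP pK]].
  by exists F; apply/taylor_minimalP/transversal_of_private/eq_r/e.
(* The facet [t] misses as many vertices as there are minimal non-faces, and the smallest facet [s]
   misses at least as many as [t]. *)
have [t ft et] := private_facet dK K0 pK.
by apply/eqP; rewrite eqn_leq le_r -et !card_compl leq_sub2l // mins.
Qed.
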